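(* For all $n\ge 1$ and all $j,k\ge 0$, there is a bijection from the set of permutations $\sigma\in S_n(231)$ with $\mathrm{des}(\sigma)=j$ and $\mathrm{maxdrop}(\sigma)\le k$ onto the set of Dyck paths of length $2n$ with $n-j$ peaks and height at most $k+1$. In particular these two sets have the same cardinality.
   Context: For a permutation $\sigma=\sigma_1\cdots\sigma_n$ of $[n]$, $\mathrm{des}(\sigma)$ is the number of $i\in[n-1]$ with $\sigma_i>\sigma_{i+1}$, and $\mathrm{maxdrop}(\sigma)=\max\{i-\sigma_i : i\in[n]\}$. $S_n(231)$ is the set of permutations of $[n]$ with no indices $a<b<c$ such that $\sigma_c<\sigma_a<\sigma_b$. A Dyck path of length $2n$ is a lattice path from $(0,0)$ to $(2n,0)$ consisting of up-steps $(1,1)$ and down-steps $(1,-1)$ that never goes below the $x$-axis. Its height is the largest $y$-coordinate it attains; a peak is a point immediately preceded by an up-step and immediately followed by a down-step. *)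

(* Defs.v *)
From HB Require Import structures.
From mathcomp Require Import all_boot all_order all_fingroup all_algebra.
From mathcomp Require Import zify.

Set Implicit Arguments.
Unset Strict Implicit.
Unset Printing Implicit Defensive.

Import Order.TTheory GRing.Theory Num.Theory.

Local Open Scope nat_scope.

(* Permutations of [n] are elements of 'S_n; positions and values are both
   numbered from 0, which affects none of the notions below. *)

Definition avoids231 n (s : 'S_n) : bool :=
  [forall a : 'I_n, forall b : 'I_n, forall c : 'I_n,
     ~~ [&& a < b, b < c, s c < s a & s a < s b]].

Definition des n (s : 'S_n) : nat :=
  #|[set i : 'I_n | [exists j : 'I_n, (val j == i.+1) && (s j < s i)]]|.

(* Truncated subtraction is harmless for n >= 1, because the position of the
   smallest value has a nonnegative drop; see maxdropP. *)
Definition maxdrop n (s : 'S_n) : nat := \max_(i < n) (i - s i).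

Lemma maxdropP n (s : 'S_n) : 0 < n ->
  (forall i : 'I_n, (i%:Z - (s i)%:Z <= (maxdrop s)%:Z)%R) /\
  (exists i : 'I_n, i%:Z - (s i)%:Z = (maxdrop s)%:Z)%R.
Proof.
case: n s => // n s _; split=> [i|].
  have /= := bigop.leq_bigmax (F := fun i : 'I_n.+1 => i - s i) i.
  by rewrite -/(maxdrop s); lia.
have [i Hi] : {i : 'I_n.+1 | maxdrop s = i - s i}.
  by apply: bigop.eq_bigmax; rewrite card_ord.
have [le_si|lt_is] := leqP (s i) i; first by exists i; lia.
exists ((s^-1)%g ord0); rewrite permKV /=.
have /= := bigop.leq_bigmax (F := fun i : 'I_n.+1 => i - s i) ((s^-1)%g ord0).
by rewrite -/(maxdrop s) permKV /=; lia.
Qed.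

Local Open Scope ring_scope.

(* A lattice path from (0,0) is encoded by its sequence of steps, true being
   the up-step (1,1) and false the down-step (1,-1); ycoord w i is the
   y-coordinate of its point of abscissa i. *)
Definition ycoord (w : seq bool) (i : nat) : int :=
  \sum_(b <- take i w) (if b then 1 else -1).

Definition is_dyck (w : seq bool) : bool :=
  [forall i : 'I_(size w).+1, 0 <= ycoord w i] && (ycoord w (size w) == 0).

(* The starting value 0 of the maximum is attained, at the origin. *)
Definition height (w : seq bool) : int :=
  \big[Num.max/0]_(i < (size w).+1) ycoord w i.

Definition npeaks (w : seq bool) : nat :=
  #|[set i : 'I_(size w).-1 | nth false w i && ~~ nth false w i.+1]|.

Definition perms231 (n j k : nat) : {set 'S_n} :=
  [set s : 'S_n | [&& avoids231 s, des s == j & (maxdrop s <= k)%N]].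

(* The number n - j of peaks is an integer, negative when j > n. *)
Definition dyck_paths (n j k : nat) : {set (n.*2).-tuple bool} :=
  [set w : (n.*2).-tuple bool |
     [&& is_dyck w, (npeaks w)%:Z == n%:Z - j%:Z & height w <= k.+1%:Z]].

(* Main.v *)
(* Let m_i be the number of positions j < i with s_j < s_i. The sequence m is a
   Lehmer code, so s |-> m is a bijection from permutations onto the sequences
   with m_i <= i, and s avoids 231 exactly when m is nondecreasing. The Dyck
   path of s then has m_i down-steps before its up-step number i (pushes and
   pops of the stack sorting of s). For s avoiding 231, a descent at i means
   m_i = m_(i+1), that is two consecutive up-steps, so there are n - des s
   peaks; and i - s_i <= i - m_i, with equality at the last position of each
   descending run, where i - m_i is largest on the run, so the height is
   maxdrop s + 1. *)
Require Import Defs.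
From mathcomp Require Import all_boot all_order all_fingroup all_algebra.
From mathcomp Require Import zify.

Set Implicit Arguments.
Unset Strict Implicit.
Unset Printing Implicit Defensive.

Import Order.TTheory GRing.Theory Num.Theory.

(** * Lehmer codes of permutations *)

Lemma card_ord_lt n p : p <= n -> #|[set j : 'I_n | j < p]| = p.
Proof.
move=> le_pn; rewrite cardsE -sum1_card (big_ord_narrow le_pn).
by rewrite sum_nat_const card_ord muln1.
Qed.

Lemma homo_leq_ord n (f : 'I_n -> nat) :
  (forall i j : 'I_n, j = i.+1 :> nat -> f i <= f j) ->
  {homo f : i j / i <= j >-> i <= j}.
Proof.
move=> step i j; move: {2}(nat_of_ord j) (erefl (nat_of_ord j)) => q.
elim: q j => [|q IHq] j jq; rewrite leq_eqVlt => /orP[/eqP/val_inj-> //|ij].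
  by rewrite jq in ij.
have q_lt : q < n by rewrite ltnW // -jq.
have := IHq (Ordinal q_lt) erefl; rewrite -ltnS -jq => /(_ ij) le_iq.
exact: leq_trans le_iq (step _ _ _).
Qed.

Definition lcode n (s : 'S_n) (i : 'I_n) : nat :=
  #|[set j : 'I_n | (j < i) && (s j < s i)]|.

Lemma lcode_le n (s : 'S_n) (i : 'I_n) : lcode s i <= i.
Proof.
rewrite -[leqRHS](card_ord_lt (ltnW (ltn_ord i))).
by apply/subset_leq_card/subsetP => j; rewrite !inE => /andP[].
Qed.

Lemma card_perm_lt n (s : 'S_n) (i : 'I_n) : #|[set j : 'I_n | s j < s i]| = s i.
Proof.
rewrite -[RHS](card_ord_lt (ltnW (ltn_ord (s i)))).
rewrite -(card_imset _ (@perm_inj _ s)); apply: eq_card => j.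
rewrite inE; apply/imsetP/idP => [[x]|lt_j]; first by rewrite inE => ? ->.
by exists ((s^-1)%g j); rewrite ?inE permKV.
Qed.

Lemma lcode_le_perm n (s : 'S_n) (i : 'I_n) : lcode s i <= s i.
Proof.
rewrite -[leqRHS]card_perm_lt; apply/subset_leq_card/subsetP => j.
by rewrite !inE => /andP[].
Qed.

Lemma lcode_eq_perm n (s : 'S_n) (i : 'I_n) :
  (forall j : 'I_n, i < j -> s i < s j) -> lcode s i = s i.
Proof.
move=> min_i; rewrite -[RHS]card_perm_lt; apply: eq_card => j; rewrite !inE.
case: (ltngtP j i) => //= [/min_i|/val_inj->]; last by rewrite ltnn.
by move/ltnW; rewrite leqNgt => /negbTE.
Qed.

Lemma perm_neq n (s : 'S_n) (i j : 'I_n) : i != j :> nat -> s i != s j :> nat.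
Proof. by rewrite !(inj_eq val_inj) (inj_eq perm_inj). Qed.

(* By induction on p, s and t order the first p positions in the same way. *)
Lemma lcode_inj n (s t : 'S_n) : lcode s =1 lcode t -> s = t.
Proof.
move=> eq_st.
have Hord p (i j : 'I_n) : i < p -> j < p -> (s i < s j) = (t i < t j).
  elim: p i j => // p IHp i j.
  have Hlast (q a : 'I_n) : q = p :> nat -> a < p -> (s a < s q) = (t a < t q).
    move=> qp lt_ap.
    pose A := [set j : 'I_n | (j < q) && (s j < s q)].
    pose B := [set j : 'I_n | (j < q) && (t j < t q)].
    have cAB : #|A| = #|B| := eq_st q.
    (* [A] and [B] are initial segments of the common order on [0, p). *)
    suff: A = B by move/setP/(_ a); rewrite !inE qp lt_ap.
    have [sAB|/subsetPn[x]] := boolP (A \subset B).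
      by apply/eqP; rewrite eqEcard sAB cAB /=.
    rewrite !inE qp => /andP[lt_xp s_xq]; rewrite lt_xp /= => t_xq.
    have {}t_xq : t q < t x.
      by have := perm_neq t (_ : x != q :> nat); lia.
    (* It remains to see [B \subset A]: for [y] in [B], [t y < t q < t x], so [s y < s x < s q] by
       induction. *)
    apply/esym/eqP; rewrite eqEcard cAB leqnn andbT.
    apply/subsetP => y; rewrite !inE qp => /andP[lt_yp t_yq].
    rewrite lt_yp (ltn_trans _ s_xq) // (IHp _ _ lt_yp lt_xp).
    exact: ltn_trans t_yq t_xq.
  rewrite !ltnS leq_eqVlt => /orP[/eqP ip|lt_ip]; last first.
    rewrite leq_eqVlt => /orP[/eqP jp|]; [exact: Hlast | exact: IHp].
  rewrite leq_eqVlt => /orP[/eqP jp|lt_jp].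
    by have -> : i = j; [apply: val_inj; rewrite /= ip jp | rewrite !ltnn].
  have ne_ij : i != j :> nat by lia.
  have := Hlast i j ip lt_jp.
  by have := perm_neq s ne_ij; have := perm_neq t ne_ij; lia.
apply/permP => i; apply: val_inj; rewrite /= -card_perm_lt -[RHS]card_perm_lt.
by apply: eq_card => j; rewrite !inE (Hord n).
Qed.

(** There are n! sequences with [m i <= i], as many as permutations, so the injective code map is
    bijective. *)
Lemma lcode_surj n (m : 'I_n -> nat) :
  (forall i, m i <= i) -> exists s : 'S_n, lcode s =1 m.
Proof.
move=> le_m.
pose code (s : 'S_n) : {dffun forall i : 'I_n, 'I_i.+1} :=
  [ffun i : 'I_n => Ordinal (lcode_le s i : _ < _.+1)].
have code_inj : injective code.
  move=> s t /ffunP eq_st; apply: lcode_inj => i.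
  by have := eq_st i; rewrite !ffunE => /(congr1 val).
have [|g _ gK] := inj_card_bij code_inj.
  rewrite card_dep_ffun foldrE big_image /=.
  rewrite card_Sn fact_prod big_add1 /= big_mkord.
  by under eq_bigr => i _ do rewrite card_ord.
pose c : {dffun forall i : 'I_n, 'I_i.+1} :=
  [ffun i : 'I_n => Ordinal (le_m i : _ < _.+1)].
exists (g c) => i.
by have /ffunP/(_ i) := gK c; rewrite !ffunE => /(congr1 val).
Qed.

(** * Avoidance of 231 and maximal drop read off the code *)

Lemma avoids231P n (s : 'S_n) :
  reflect (forall a b c : 'I_n, a < b -> b < c -> s c < s a -> s b < s a)
          (avoids231 s).
Proof.
apply: (iffP forallP) => [H a b c ab bc ca|H a].
  move/forallP/(_ b)/forallP/(_ c): (H a); rewrite ab bc ca /=.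
  by have := perm_neq s (_ : a != b :> nat); lia.
apply/forallP => b; apply/forallP => c; apply/negP => /and4P[ab bc ca].
by have := H a b c ab bc ca; lia.
Qed.

(** Whatever is counted at [i] is counted at [j], and so is [i] itself. *)
Lemma lcode_ascent n (s : 'S_n) (i j : 'I_n) :
  i < j -> s i < s j -> lcode s i < lcode s j.
Proof.
move=> ij sij; apply/proper_card/properP; split.
  apply/subsetP => x; rewrite !inE => /andP[xi sxi].
  by rewrite (ltn_trans xi) // (ltn_trans sxi).
by exists i; rewrite !inE ?ij ?sij ?ltnn.
Qed.

Lemma lcode_descent_subset n (s : 'S_n) (i j : 'I_n) : j = i.+1 :> nat -> s j < s i ->
  [set x : 'I_n | (x < j) && (s x < s j)] \subset
  [set x : 'I_n | (x < i) && (s x < s i)].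
Proof.
move=> ji sji; apply/subsetP => x; rewrite !inE ji ltnS leq_eqVlt.
case/andP=> /orP[/eqP/val_inj->|-> sx]; first by rewrite ltnNge (ltnW sji).
exact: ltn_trans sji.
Qed.

Lemma lcode_descent n (s : 'S_n) (i j : 'I_n) :
  j = i.+1 :> nat -> s j < s i -> lcode s j <= lcode s i.
Proof. by move=> ji sji; apply: subset_leq_card; apply: lcode_descent_subset. Qed.

Lemma lcode_avoids231 n (s : 'S_n) :
  avoids231 s <-> {homo lcode s : i j / i <= j >-> i <= j}.
Proof.
split=> [/avoids231P av|mono].
  apply: homo_leq_ord => i j ji; have ij : i < j by rewrite ji.
  have [sij|sji] := ltnP (s i) (s j); first exact/ltnW/lcode_ascent.
  (* At a descent, an [x] counted at [i] but not at [j] would have [s j < s x < s i], so [x], [i],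
     [j] would form 231. *)
  apply/subset_leq_card/subsetP => x; rewrite !inE => /andP[xi sxi].
  rewrite (ltn_trans xi ij) ltnNge /=; apply/negP => sjx.
  by have := av x i j xi ij; have := perm_neq s (_ : x != j :> nat); lia.
apply/avoids231P => a b c ab bc sca.
apply: contraT => nsba.
have sab : s a < s b by have := perm_neq s (_ : a != b :> nat); lia.
(* A descent from above [s a] to below it would make [lcode s] drop strictly,
   because [a] stops being counted; so no value after [b] gets below [s a]. *)
suff H q (x : 'I_n) : x = q :> nat -> b <= x -> s a < s x.
  by have := H c c erefl (ltnW bc); lia.
elim: q x => [|q IHq] x xq; rewrite leq_eqVlt => /orP[/eqP/val_inj<- //|bx].
  by rewrite xq in bx.
have q_lt : q < n by rewrite ltnW // -xq.
pose y := Ordinal q_lt.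
have xy : x = y.+1 :> nat by [].
have sy : s a < s y by apply: IHq => //=; rewrite -ltnS -xq.
apply: contraT => nsax.
have ax : a < x := ltn_trans ab bx.
have sx : s x < s a by have := perm_neq s (_ : a != x :> nat); lia.
have ay : a < y.
  by rewrite -ltnS -xy; apply: leq_ltn_trans bx.
have sxy := ltn_trans sx sy.
suff : lcode s x < lcode s y by rewrite ltnNge mono //= -ltnS -xq.
apply/proper_card/properP; split; first exact: lcode_descent_subset.
by exists a; rewrite !inE ?ay ?sy ?ax // -leqNgt ltnW.
Qed.

Lemma maxdrop_lcode n (s : 'S_n) k : avoids231 s ->
  maxdrop s <= k <-> forall i : 'I_n, i - lcode s i <= k.
Proof.
move=> /avoids231P av; split=> [/bigmax_leqP drop_le|le_k]; last first.
  apply/bigmax_leqP => i _; apply: leq_trans (le_k i).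
  exact/leq_sub2l/lcode_le_perm.
(* Induction from the last position backwards: at a descent [i - lcode s i] grows when [i] moves
   right, so the bound is inherited from the next position. *)
suff H d (i : 'I_n) : n - i <= d -> i - lcode s i <= k.
  by move=> i; apply: H (leqnn _).
elim: d i => [|d IHd] i; first by have := ltn_ord i; lia.
move=> le_d; have := drop_le i isT.
have [lt_n|ge_n] := ltnP i.+1 n; last first.
  by rewrite lcode_eq_perm // => j; have := ltn_ord j; lia.
pose j := Ordinal lt_n; have ij : i < j by rewrite /=.
have [sij _|nsij] := boolP (s j < s i).
  have : j - lcode s j <= k by apply: IHd => /=; lia.
  by have := lcode_descent (erefl : j = i.+1 :> nat) sij; rewrite /=; lia.
(* [i] is not a descent, so all later values exceed [s i]: a smaller one at [x] would form 231 with
   [i] and [j]. *)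
rewrite lcode_eq_perm // => x ix; apply: contraT => nsix.
have sxi : s x < s i by have := perm_neq s (_ : x != i :> nat); lia.
have jx : j < x.
  rewrite ltn_neqAle ix andbT; apply: contraNneq nsij => jx.
  by have -> : j = x by apply: val_inj.
by case/negP: nsij; apply: av sxi.
Qed.

(** * Words described by the positions of their up-steps *)

(** Up-step [i] starts at abscissa [u i]. The default [false] forces every [u i] to lie inside
    [w]. *)
Definition enumerates n (u : 'I_n -> nat) (w : seq bool) : Prop :=
  {homo u : i j / i < j >-> i < j} /\
  forall p, nth false w p = [exists i, u i == p].

Lemma count_takeS (w : seq bool) p :
  count id (take p.+1 w) = count id (take p w) + nth false w p.
Proof.
have [lt_p|ge_p] := ltnP p (size w).
  by rewrite (take_nth false lt_p) -cats1 count_cat /= addn0.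
by rewrite nth_default // addn0 !take_oversize // ltnW.
Qed.

Lemma enumerates_inj n (u : 'I_n -> nat) w :
  enumerates u w -> injective u.
Proof.
move=> [mono _] i j eq_u; apply: val_inj => /=.
by have := mono i j; have := mono j i; lia.
Qed.

Lemma count_take_card n (u : 'I_n -> nat) w p :
  enumerates u w -> count id (take p w) = #|[set i | u i < p]|.
Proof.
move=> uw; have u_inj := enumerates_inj uw; case: uw => _ w_nth.
elim: p => [|p IHp]; first by rewrite take0; apply/esym/eq_card0 => i; rewrite inE.
rewrite count_takeS IHp w_nth.
have [/existsP[i /eqP ui]|none] := boolP [exists i, u i == p].
  rewrite (_ : [set j | u j < p.+1] = i |: [set j | u j < p]).
    by rewrite cardsU1 inE ui ltnn addnC.
  by apply/setP => j; rewrite !inE ltnS leq_eqVlt -ui (inj_eq u_inj).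
rewrite addn0; apply: eq_card => j; rewrite !inE.
by have /existsPn/(_ j) := none; lia.
Qed.

(** As [u] increases, the up-steps starting before [p] are the first ones. This converts counts in
    prefixes, hence ordinates, into inequalities on [u]. *)
Lemma ltn_count_take n (u : 'I_n -> nat) w p (i : 'I_n) :
  enumerates u w -> (i < count id (take p w)) = (u i < p).
Proof.
move=> uw; rewrite (count_take_card p uw); case: uw => mono _.
apply/idP/idP => [|lt_p].
  apply: contraTT; rewrite -!leqNgt => le_p.
  rewrite -[leqRHS](card_ord_lt (ltnW (ltn_ord i))).
  apply/subset_leq_card/subsetP => j; rewrite !inE => uj.
  case: (ltngtP j i) => // [/mono|/val_inj ji]; first by lia.
  by move: uj; rewrite ji; lia.
rewrite -[leqLHS](card_ord_lt (ltn_ord i)).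
apply/subset_leq_card/subsetP => j; rewrite !inE ltnS leq_eqVlt.
by case/orP => [/eqP/val_inj-> //|/mono]; lia.
Qed.

Lemma enumerates_lt_size n (u : 'I_n -> nat) w i :
  enumerates u w -> u i < size w.
Proof.
case=> _ /(_ (u i)) w_nth; rewrite ltnNge; apply/negP => ge_u.
by move: w_nth; rewrite nth_default // => /esym/existsP[]; exists i.
Qed.

Lemma count_take_le n (u : 'I_n -> nat) w p :
  enumerates u w -> count id (take p w) <= n.
Proof.
by move=> uw; rewrite (count_take_card p uw) -[leqRHS]card_ord max_card.
Qed.

Lemma count_enumerates n (u : 'I_n -> nat) w :
  enumerates u w -> count id w = n.
Proof.
move=> uw; rewrite -[w in LHS]take_size (count_take_card _ uw) -[RHS]card_ord.
by apply: eq_card => i; rewrite !inE (enumerates_lt_size _ uw).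
Qed.

(** By [ltn_count_take], [w] alone decides whether [u i < p]; take [p] to be [u i] and [v i]. *)
Lemma enumerates_uniq n (u v : 'I_n -> nat) w :
  enumerates u w -> enumerates v w -> u =1 v.
Proof.
move=> uw vw i.
have := ltn_count_take (u i) i vw; have := ltn_count_take (v i) i uw.
have := ltn_count_take (u i) i uw; have := ltn_count_take (v i) i vw; lia.
Qed.

Lemma enumerates_word n (u v : 'I_n -> nat) w w' :
  u =1 v -> size w = size w' -> enumerates u w -> enumerates v w' -> w = w'.
Proof.
move=> eq_uv eq_sz [_ w_nth] [_ w'_nth]; apply: (eq_from_nth (x0 := false)) => // p _.
by rewrite w_nth w'_nth; apply: eq_existsb => i; rewrite eq_uv.
Qed.

Lemma enumerates_exists (w : seq bool) :
  exists u : 'I_(count id w) -> nat, enumerates u w.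
Proof.
pose s := [seq p <- iota 0 (size w) | nth false w p].
have sz_s : size s = count id w.
  by rewrite size_filter -[w in RHS](mkseq_nth false) count_map.
have s_sorted : sorted ltn s.
  by apply: sorted_filter (iota_ltn_sorted _ _); exact: ltn_trans.
exists (fun i => nth 0 s i); split=> [i j ij|p].
  by apply: (sorted_ltn_nth ltn_trans) => //; rewrite inE sz_s.
transitivity (p \in s).
  rewrite mem_filter mem_iota /= add0n andbC; case: ltnP => // ge_p.
  by rewrite nth_default.
apply/(nthP 0)/existsP => [[i lt_i <-]|[i /eqP <-]].
  by rewrite sz_s in lt_i; exists (Ordinal lt_i).
by exists i; rewrite ?sz_s.
Qed.

(** * Dyck condition, height and peaks in terms of up-step positions *)

Lemma sum_steps (w : seq bool) :
  (\sum_(b <- w) (if b then 1 else -1) = (count id w).*2%:Z - (size w)%:Z :> int)%R.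
Proof. by elim: w => [|[] w IHw]; rewrite ?big_nil // big_cons IHw /=; lia. Qed.

Lemma ycoordE w p : p <= size w ->
  ycoord w p = ((count id (take p w)).*2%:Z - p%:Z)%R.
Proof. by move=> le_p; rewrite /ycoord sum_steps size_takel. Qed.

Lemma is_dyck_count w : is_dyck w -> (count id w).*2 = size w.
Proof.
by case/andP=> _; rewrite ycoordE // take_size subr_eq0 => /eqP[].
Qed.

(** The path is lowest just before an up-step or at its end, and before up-step [i] its ordinate is
    [2i - u i]. *)
Lemma is_dyckE n (u : 'I_n -> nat) w : enumerates u w -> size w = n.*2 ->
  is_dyck w <-> forall i, u i <= i.*2.
Proof.
move=> uw sz_w; rewrite /is_dyck; split=> [/andP[/forallP ge0 _] i|le_u].
  have lt_u : u i < (size w).+1 by apply/ltnW/(enumerates_lt_size _ uw).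
  have /= := ge0 (Ordinal lt_u); rewrite ycoordE //.
  by have := ltn_count_take (u i) i uw; lia.
rewrite ycoordE // take_size (count_enumerates uw) sz_w subrr eqxx andbT.
apply/forallP => p; rewrite ycoordE; last by have := ltn_ord p; lia.
have [lt_c|ge_c] := ltnP (count id (take p w)) n; last by have := ltn_ord p; lia.
(* With [c] up-steps before [p], up-step [c] starts at [u c >= p], so the ordinate [2c - p] is at
   least [2c - u c]. *)
have := le_u (Ordinal lt_c); have := ltn_count_take p (Ordinal lt_c) uw => /=; lia.
Qed.

(** A positive maximum is reached just after an up-step, and after up-step [i] the ordinate is
    [2(i+1) - (u i + 1)]. *)
Lemma height_le n (u : 'I_n -> nat) w k : enumerates u w ->
  (height w <= k.+1%:Z)%R <-> forall i : 'I_n, i.*2 <= u i + k.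
Proof.
move=> uw; rewrite /height; split=> [le_k i|le_u].
  have lt_u : (u i).+1 < (size w).+1 by rewrite ltnS (enumerates_lt_size _ uw).
  pose y (p : 'I_(size w).+1) := ycoord w p.
  have := le_trans (le_bigmax 0%R y (Ordinal lt_u)) le_k; rewrite /y.
  by rewrite /= ycoordE //; have := ltn_count_take (u i).+1 i uw; lia.
apply/bigmax_leP; split=> // p _; rewrite ycoordE; last by have := ltn_ord p; lia.
case c_eq: (count id (take p w)) => [|c]; first by lia.
(* The last up-step before [p] has number [c], so [u c < p]. *)
have lt_c : c < n by rewrite -c_eq (count_take_le _ uw).
have := le_u (Ordinal lt_c); have := ltn_count_take p (Ordinal lt_c) uw => /=; lia.
Qed.

(** Peaks are the up-steps not followed by another one; the bound on [u] puts each up-step in the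
    index range of [npeaks]. *)
Lemma npeaks_card n (u : 'I_n -> nat) w : enumerates u w ->
  (forall i, (u i).+1 < size w) ->
  npeaks w = #|[set i | ~~ [exists j, u j == (u i).+1]]|.
Proof.
move=> uw lt_u; have u_inj := enumerates_inj uw; case: uw => _ w_nth.
have lt_u' i : u i < (size w).-1 by have := lt_u i; lia.
pose g i := Ordinal (lt_u' i).
have g_inj : injective g by move=> i j /(congr1 val)/u_inj.
rewrite /npeaks -(card_imset _ g_inj); apply: eq_card => p; rewrite inE.
apply/andP/imsetP => [[]|[i]].
  rewrite w_nth => /existsP[i /eqP ui] np.
  by exists i; [rewrite inE ui -w_nth | apply: val_inj].
rewrite inE => np ->; rewrite /= !w_nth; split=> //.
by apply/existsP; exists i.
Qed.

(** * The Dyck path of a permutation *)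

(** When [s] avoids 231, up-step [i] comes after [i] up-steps and [lcode s i] down-steps, hence its
    position. *)
Definition word n (s : 'S_n) : (n.*2).-tuple bool :=
  [tuple [exists i : 'I_n, i + lcode s i == p] | p < n.*2].

Lemma word_enumerates n (s : 'S_n) : avoids231 s ->
  enumerates (fun i => i + lcode s i) (word s).
Proof.
move=> /lcode_avoids231 mono; split=> [i j ij|p].
  by have := mono i j (ltnW ij); lia.
have [lt_p|ge_p] := ltnP p n.*2.
  by rewrite -[p]/(val (Ordinal lt_p)) -tnth_nth tnth_mktuple.
rewrite nth_default ?size_tuple //; apply/esym/existsP => -[i /eqP ip].
by have := lcode_le s i; have := ltn_ord i; lia.
Qed.

(** Up-step [i] is followed by another up-step exactly when [i] is a descent. *)
Lemma npeaks_word n (s : 'S_n) : avoids231 s -> npeaks (word s) + des s = n.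
Proof.
move=> av; have sw := word_enumerates av.
rewrite (npeaks_card sw) => [|i]; last first.
  by rewrite size_tuple; have := lcode_le s i; have := ltn_ord i; lia.
pose D := [set i : 'I_n | [exists j : 'I_n, (val j == i.+1) && (s j < s i)]].
rewrite addnC -[RHS]card_ord -(cardsC D); congr (_ + _).
apply: eq_card => i; rewrite /D !inE; congr (~~ _).
have /lcode_avoids231 mono := av.
apply/existsP/existsP => -[j] => [/eqP uj|/andP[/eqP ji sji]]; exists j.
  have ij : i < j.
    by rewrite ltnNge; apply/negP => ji; have := mono j i ji; lia.
  have := mono i j (ltnW ij) => le_ij.
  (* From [j + lcode s j = i + lcode s i + 1] and monotonicity, [j] is [i.+1] with the same code,
     which excludes an ascent. *)
  have ji : j = i.+1 :> nat by lia.
  rewrite /= ji eqxx /=.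
  have := perm_neq s (_ : i != j :> nat); have := @lcode_ascent _ s i j ij; lia.
have ij : i <= j by rewrite ji.
by have := lcode_descent ji sji; have := mono i j ij; move: ji => /=; lia.
Qed.

Theorem theorem7 (n j k : nat) (hn : (1 <= n)%N) :
  (exists f : 'S_n -> (n.*2).-tuple bool,
     {in perms231 n j k &, injective f} /\
     f @: perms231 n j k = dyck_paths n j k) /\
  #|perms231 n j k| = #|dyck_paths n j k|.
Proof.
have word_inj : {in perms231 n j k &, injective (@word n)}.
  move=> s t; rewrite !inE => /and3P[/word_enumerates sw _ _].
  move=> /and3P[/word_enumerates tw _ _] eq_w.
  apply: lcode_inj => i; rewrite eq_w in sw.
  exact: addnI (enumerates_uniq sw tw i).
suff word_im : @word n @: perms231 n j k = dyck_paths n j k.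
  by split; [exists (@word n) | rewrite -word_im card_in_imset].
have word_dyck (s : 'S_n) : avoids231 s ->
    (word s \in dyck_paths n j k) = (s \in perms231 n j k).
  move=> av; have sw := word_enumerates av; rewrite !inE av andTb.
  have -> : is_dyck (word s).
    apply/(is_dyckE sw); first by rewrite size_tuple.
    by move=> i; have := lcode_le s i; lia.
  rewrite andTb; congr (_ && _).
    by have := npeaks_word av => n_eq; apply/eqP/eqP; lia.
  apply/idP/idP => [/(height_le _ sw) le_k|/(maxdrop_lcode _ av) le_k].
    by apply/(maxdrop_lcode _ av) => i; have := le_k i; lia.
  by apply/(height_le _ sw) => i; have := le_k i; lia.
apply/setP => w; apply/imsetP/idP => [[s s_in ->]|w_in].
  by rewrite word_dyck //; move: s_in; rewrite inE => /and3P[].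
have w_dyck : is_dyck w by move: w_in; rewrite inE => /and3P[].
(* A Dyck path of length [2n] has exactly [n] up-steps. *)
have [u uw] : exists u : 'I_n -> nat, enumerates u w.
  have := enumerates_exists w; have := is_dyck_count w_dyck.
  by rewrite size_tuple => /double_inj->.
have le_u := (is_dyckE uw (size_tuple w)).1 w_dyck.
(* This makes the truncated [u i - i] below the true number of down-steps before up-step [i]. *)
have u_ge (i : 'I_n) : i <= u i.
  case: i => i; elim: i => // i IHi lt_i.
  apply: leq_ltn_trans (IHi (ltnW lt_i)) _.
  by case: uw => mono _; apply: mono.
have [|s s_code] := @lcode_surj n (fun i => u i - i).
  by move=> i; have := le_u i; lia.
have us i : u i = i + lcode s i by rewrite s_code subnKC.
have av : avoids231 s.
  (* [u] is strictly increasing, so [u i - i] is nondecreasing. *)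
  apply/lcode_avoids231/homo_leq_ord => i i' ii'.
  by rewrite !s_code; case: uw => mono _; have := mono i i'; lia.
have w_s : w = word s.
  apply: val_inj; apply: enumerates_word us _ uw (word_enumerates av).
  by rewrite !size_tuple.
by exists s => //; rewrite -word_dyck // -w_s.
Qed.
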